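(* Let $V^-$ and $V^+$ be the lower and upper value functions, and let $\mathcal{R}^-$ and $\mathcal{R}^+$ be the lower and upper robust controlled invariant sets, of the differential game described in the context. Then $$\mathcal{R}^{-}=\{\bm{x}\in\mathbb{R}^n\mid V^{-}(\bm{x})=0\}\quad\text{and}\quad \mathcal{R}^{+}=\{\bm{x}\in\mathbb{R}^n\mid V^{+}(\bm{x})=0\}.$$
   Context: Setting. $U\subset\mathbb{R}^m$ and $D\subset\mathbb{R}^l$ are compact. $\bm{f}:\mathbb{R}^n\times U\times D\to\mathbb{R}^n$ is continuous in $(\bm{x},\bm{u},\bm{d})$ and locally Lipschitz in $\bm{x}$ uniformly in $(\bm{u},\bm{d})\in U\times D$. $\mathcal{U}$ is the set of measurable functions $\bm{u}(\cdot):[0,\infty)\to U$, and $\mathcal{D}$ is the set of measurable functions $\bm{d}(\cdot):[0,\infty)\to D$. For $\bm{x}\in\mathbb{R}^n$, $\bm{u}(\cdot)\in\mathcal{U}$, $\bm{d}(\cdot)\in\mathcal{D}$, $\bm{\phi}_{\bm{x}}^{\bm{u},\bm{d}}:[0,\infty)\to\mathbb{R}^n$ denotes the (Carathéodory) solution of $\dot{\bm{x}}(s)=\bm{f}(\bm{x}(s),\bm{u}(s),\bm{d}(s))$ with $\bm{\phi}_{\bm{x}}^{\bm{u},\bm{d}}(0)=\bm{x}$; it is assumed to exist on all of $[0,\infty)$ and to be unique. Non-anticipative strategies. $\Gamma$ is the set of maps $\bm{\alpha}(\cdot):\mathcal{D}\to\mathcal{U}$ such that for every $s\ge 0$ and all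 $\bm{d}_1,\bm{d}_2\in\mathcal{D}$ with $\bm{d}_1(t)=\bm{d}_2(t)$ for a.e. $t\in[0,s]$, one has $\bm{\alpha}(\bm{d}_1)(t)=\bm{\alpha}(\bm{d}_2)(t)$ for a.e. $t\in[0,s]$. $\Delta$ is the analogously defined set of non-anticipative maps $\bm{\beta}(\cdot):\mathcal{U}\to\mathcal{D}$. Robust controlled invariant sets. $h:\mathbb{R}^n\to\mathbb{R}$ is bounded and locally Lipschitz, and $\mathcal{X}_\epsilon=\{\bm{x}\in\mathbb{R}^n\mid h(\bm{x})\le\epsilon\}$. Then $$\mathcal{R}^-=\{\bm{x}\in\mathbb{R}^n\mid\forall\epsilon>0,\ \forall T\ge0,\ \exists\bm{\alpha}\in\Gamma,\ \forall\bm{d}\in\mathcal{D},\ \forall t\in[0,T],\ \bm{\phi}_{\bm{x}}^{\bm{\alpha}(\bm{d}),\bm{d}}(t)\in\mathcal{X}_\epsilon\},$$ $$\mathcal{R}^+=\{\bm{x}\in\mathbb{R}^n\mid\forall\epsilon>0,\ \forall T\ge0,\ \forall\bm{\beta}\in\Delta,\ \exists\bm{u}\in\mathcal{U},\ \forall t\in[0,T],\ \bm{\phi}_{\bm{x}}^{\bm{u},\bm{\beta}(\bm{u})}(t)\in\mathcal{X}_\epsilon\}.$$ Value functions. Fix $\gamma\in(0,\infty)$ and set $J(\bm{x},\bm{u},\bm{d})=\sup_{t\in[0,\infty)}e^{-\gamma t}h(\bm{\phi}_{\bm{x}}^{\bm{u},\bm{d}}(t))$, $$V^-(\bm{x})=\inf_{\bm{\alpha}\in\Gamma}\sup_{\bm{d}\in\mathcal{D}}J(\bm{x},\bm{\alpha}(\bm{d}),\bm{d}),\qquad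 V^+(\bm{x})=\sup_{\bm{\beta}\in\Delta}\inf_{\bm{u}\in\mathcal{U}}J(\bm{x},\bm{u},\bm{\beta}(\bm{u})).$$ *)

(* Defs.v *)
From mathcomp Require Import all_boot all_order all_algebra.
From mathcomp Require Import all_classical all_reals all_analysis.
From mathcomp Require Import measurable_realfun.

Set Implicit Arguments.
Unset Strict Implicit.
Unset Printing Implicit Defensive.
Import Order.TTheory GRing.Theory Num.Theory.
Import numFieldNormedType.Exports.
Local Open Scope classical_set_scope.
Local Open Scope ring_scope.

(* Functions on [0, +oo[ are represented by functions on R whose values at
   negative times are irrelevant. *)

Definition lebesgueType (R : realType) :=
  g_sigma_algebraType (completed_algebra_gen (@lebesgue_measure R)).

Definition borelType (R : realType) (k : nat) :=
  g_sigma_algebraType (@open 'rV[R]_k).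

(* Lebesgue-measurable functions [0, +oo[ -> A (the domain carries the
   Lebesgue sigma-algebra, not just the Borel one). *)
Definition signals (R : realType) (k : nat) (A : set 'rV[R]_k) :
    set (R -> 'rV[R]_k) :=
  [set u : R -> 'rV[R]_k |
    measurable_fun (`[0, +oo[ : set (lebesgueType R))
      (u : lebesgueType R -> borelType R k) /\
    forall t : R, 0 <= t -> A (u t)].

Definition ae_eq_upto (R : realType) (T : Type) (s : R) (v w : R -> T) : Prop :=
  {ae @lebesgue_measure R, forall t : R, 0 <= t <= s -> v t = w t}.

(* A strategy is only constrained on admissible signals, and only its values
   there matter. *)
Definition nonanticipative (R : realType) (k l : nat)
    (A : set 'rV[R]_k) (B : set 'rV[R]_l) :
    set ((R -> 'rV[R]_k) -> (R -> 'rV[R]_l)) :=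
  [set a | (forall v, signals A v -> signals B (a v)) /\
    forall (s : R) v1 v2, 0 <= s -> signals A v1 -> signals A v2 ->
      ae_eq_upto s v1 v2 -> ae_eq_upto s (a v1) (a v2)].

Definition absolutely_continuous (R : realType) (V : normedModType R)
    (a b : R) (y : R -> V) : Prop :=
  forall e : R, 0 < e -> exists2 r : R, 0 < r &
    forall (k : nat) (p q : 'I_k -> R),
      (forall i, a <= p i /\ p i <= q i /\ q i <= b) ->
      trivIset [set: 'I_k] (fun i => `]p i, q i[%classic) ->
      \sum_(i < k) (q i - p i) < r ->
      \sum_(i < k) `|y (q i) - y (p i)| < e.

(* Caratheodory solution on [0, +oo[: locally absolutely continuous, with the
   differential equation holding at almost every time. *)
Definition solution (R : realType) (n m l : nat)
    (f : 'rV[R]_n -> 'rV[R]_m -> 'rV[R]_l -> 'rV[R]_n)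
    (x : 'rV[R]_n) (u : R -> 'rV[R]_m) (d : R -> 'rV[R]_l)
    (y : R -> 'rV[R]_n) : Prop :=
  [/\ y 0 = x,
      forall T : R, 0 <= T -> absolutely_continuous 0 T y &
      {ae @lebesgue_measure R, forall t : R, 0 < t ->
        is_derive t 1 y (f (y t) (u t) (d t))}].

Definition sublevel (R : realType) (n : nat) (h : 'rV[R]_n -> R) (e : R) :
    set 'rV[R]_n :=
  [set x | h x <= e].

Definition lower_invariant (R : realType) (n m l : nat)
    (U : set 'rV[R]_m) (D : set 'rV[R]_l) (h : 'rV[R]_n -> R)
    (phi : 'rV[R]_n -> (R -> 'rV[R]_m) -> (R -> 'rV[R]_l) -> R -> 'rV[R]_n) :
    set 'rV[R]_n :=
  [set x | forall e : R, 0 < e -> forall T : R, 0 <= T ->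
    exists2 a, nonanticipative D U a &
      forall d, signals D d -> forall t : R, 0 <= t <= T ->
        sublevel h e (phi x (a d) d t)].

Definition upper_invariant (R : realType) (n m l : nat)
    (U : set 'rV[R]_m) (D : set 'rV[R]_l) (h : 'rV[R]_n -> R)
    (phi : 'rV[R]_n -> (R -> 'rV[R]_m) -> (R -> 'rV[R]_l) -> R -> 'rV[R]_n) :
    set 'rV[R]_n :=
  [set x | forall e : R, 0 < e -> forall T : R, 0 <= T ->
    forall b, nonanticipative U D b ->
      exists2 u, signals U u & forall t : R, 0 <= t <= T ->
        sublevel h e (phi x u (b u) t)].

(* Suprema and infima are taken in the extended reals. *)

Definition cost (R : realType) (n m l : nat) (gamma : R) (h : 'rV[R]_n -> R)
    (phi : 'rV[R]_n -> (R -> 'rV[R]_m) -> (R -> 'rV[R]_l) -> R -> 'rV[R]_n)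
    (x : 'rV[R]_n) (u : R -> 'rV[R]_m) (d : R -> 'rV[R]_l) : \bar R :=
  ereal_sup [set (expR (- (gamma * t)) * h (phi x u d t))%:E
            | t in (`[0, +oo[ : set R)].

Definition lower_value (R : realType) (n m l : nat)
    (U : set 'rV[R]_m) (D : set 'rV[R]_l) (gamma : R) (h : 'rV[R]_n -> R)
    (phi : 'rV[R]_n -> (R -> 'rV[R]_m) -> (R -> 'rV[R]_l) -> R -> 'rV[R]_n)
    (x : 'rV[R]_n) : \bar R :=
  ereal_inf [set ereal_sup [set cost gamma h phi x (a d) d | d in signals D]
            | a in nonanticipative D U].

Definition upper_value (R : realType) (n m l : nat)
    (U : set 'rV[R]_m) (D : set 'rV[R]_l) (gamma : R) (h : 'rV[R]_n -> R)
    (phi : 'rV[R]_n -> (R -> 'rV[R]_m) -> (R -> 'rV[R]_l) -> R -> 'rV[R]_n)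
    (x : 'rV[R]_n) : \bar R :=
  ereal_sup [set ereal_inf [set cost gamma h phi x u (b u) | u in signals U]
            | b in nonanticipative U D].

(* Main.v *)
Require Import Defs.
From mathcomp Require Import all_boot all_order all_algebra.
From mathcomp Require Import all_classical all_reals all_analysis.

Set Implicit Arguments.
Unset Strict Implicit.
Unset Printing Implicit Defensive.
Import Order.TTheory GRing.Theory Num.Theory.
Import numFieldNormedType.Exports.
Local Open Scope classical_set_scope.
Local Open Scope ring_scope.

(** Both players optimise the same discounted supremum cost, and the
    theorem rests on two features of that cost.

    Since h is bounded, the discount makes the running reward
    expR (- (gamma * t)) * h uniformly small after a finite horizon
    ([discounted_tail]). Hence every cost is nonnegative ([cost_ge0]), and
    therefore so are both values: a constant signal of the second player is
    admissible, and the constant strategy playing it is nonanticipative, so the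
    suprema in the two values are not over empty families.

    Cost and constraint violation control each other over a finite horizon. A
    trajectory that keeps h below e > 0 up to the tail horizon has cost at most
    e ([cost_le]); conversely a cost of at most expR (- (gamma * T)) * e keeps
    h below e on [0, T], as undoing the discount loses a factor of at most
    expR (gamma * T) there ([cost_sublevel]). Quantified over strategies, the
    first bound gives value <= e for every e > 0 on an invariant set, so the
    value is 0; the second turns near-optimal play at value 0 into play
    witnessing invariance, for every e and T. *)

Section DiscountedCost.
Context (R : realType) (n m l : nat) (gamma : R) (h : 'rV[R]_n -> R).
Context (phi : 'rV[R]_n -> (R -> 'rV[R]_m) -> (R -> 'rV[R]_l) -> R -> 'rV[R]_n).
Implicit Types (x : 'rV[R]_n) (u : R -> 'rV[R]_m) (d : R -> 'rV[R]_l).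

Lemma discounted_tail (e : R) : bounded_fun h -> 0 < gamma -> 0 < e ->
  exists2 T : R, 0 <= T & forall (t : R) (x : 'rV[R]_n), T <= t ->
    `|expR (- (gamma * t)) * h x| <= e.
Proof.
move=> /pinfty_ex_gt0[M M0 hM] g0 e0.
(* 1 + gamma * t <= expR (gamma * t), so gamma * T = M / e is late enough. *)
exists (M / e / gamma); first by rewrite !divr_ge0 ?ltW.
move=> t x Tt; rewrite normrM ger0_norm ?expR_ge0// expRN mulrC.
rewrite ler_pdivrMr ?expR_gt0//; apply: le_trans (hM x I) _.
rewrite -ler_pdivrMl// mulrC; apply: le_trans (expR_ge1Dx _).
apply: le_trans (_ : gamma * t <= _); last by rewrite lerDr.
by rewrite [gamma * t]mulrC -ler_pdivrMr// [e^-1 * M]mulrC.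
Qed.

Lemma cost_ge (x : 'rV[R]_n) u d (t : R) : 0 <= t ->
  ((expR (- (gamma * t)) * h (phi x u d t))%:E <= cost gamma h phi x u d)%E.
Proof.
by move=> t0; apply: ereal_sup_ubound; exists t => //=; rewrite in_itv/= t0.
Qed.

(** The reward at late times is at least -e for every e > 0. *)
Lemma cost_ge0 x u d : bounded_fun h -> 0 < gamma ->
  (0 <= cost gamma h phi x u d)%E.
Proof.
move=> hb g0; apply/lee_addgt0Pr => e e0.
have [T T0 tail] := discounted_tail hb g0 e0.
apply: le_trans (leeD2r _ (cost_ge x u d T0)).
rewrite -EFinD lee_fin -lerBlDr sub0r.
by have /ler_normlP[] := tail T (phi x u d T) (lexx _); rewrite lerNl.
Qed.

(** The horizon is uniform in the trajectory, hence can be fixed before the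
    strategies are chosen. *)
Lemma cost_le (e : R) : bounded_fun h -> 0 < gamma -> 0 < e ->
  exists2 T : R, 0 <= T & forall x u d,
    (forall t : R, 0 <= t <= T -> sublevel h e (phi x u d t)) ->
    (cost gamma h phi x u d <= e%:E)%E.
Proof.
move=> hb g0 e0; have [T T0 tail] := discounted_tail hb g0 e0.
exists T => // x u d inv; apply: ge_ereal_sup => _ /= [t + <-].
rewrite in_itv/= andbT lee_fin => t0.
have [tT|/ltW Tt] := leP t T; last exact: le_trans (ler_norm _) (tail _ _ Tt).
have he : h (phi x u d t) <= e by apply: inv; rewrite t0.
apply: le_trans (ler_wpM2l (expR_ge0 _) he) _.
by rewrite ler_piMl ?(ltW e0)// expR_le1 oppr_le0 mulr_ge0// ltW.
Qed.

Lemma cost_sublevel (e T : R) x u d : 0 < gamma -> 0 < e ->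
  (cost gamma h phi x u d <= (expR (- (gamma * T)) * e)%:E)%E ->
  forall t : R, 0 <= t <= T -> sublevel h e (phi x u d t).
Proof.
move=> g0 e0 Je t /andP[t0 tT].
have := le_trans (cost_ge x u d t0) Je; rewrite lee_fin => hle.
rewrite /sublevel/= -(ler_pM2l (expR_gt0 (- (gamma * t)))).
apply: (le_trans hle).
by rewrite ler_pM2r// ler_expR lerN2 ler_pM2l.
Qed.

End DiscountedCost.

Section ConstantPlay.
Context (R : realType) (k l : nat) (A : set 'rV[R]_k) (B : set 'rV[R]_l).

Lemma signals_cst (a : 'rV[R]_k) : A a -> signals A (cst a).
Proof. by move=> Aa; split=> //; exact: measurable_cst. Qed.

Lemma nonanticipative_cst (w : R -> 'rV[R]_l) :
  signals B w -> nonanticipative A B (cst w).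
Proof. by move=> Bw; split=> // s v1 v2 _ _ _ _; exact: aeW. Qed.

End ConstantPlay.

Section Values.
Context (R : realType) (n m l : nat) (U : set 'rV[R]_m) (D : set 'rV[R]_l).
Context (gamma : R) (h : 'rV[R]_n -> R).
Context (phi : 'rV[R]_n -> (R -> 'rV[R]_m) -> (R -> 'rV[R]_l) -> R -> 'rV[R]_n).
Hypotheses (D_nonempty : D !=set0) (hb : bounded_fun h) (g0 : 0 < gamma).

Lemma lower_value_ge0 x : (0 <= lower_value U D gamma h phi x)%E.
Proof.
have [d0 Dd0] := D_nonempty; apply: le_ereal_inf_tmp => _ /= [a _ <-].
apply: le_ereal_sup_tmp; exists (cost gamma h phi x (a (cst d0)) (cst d0)).
  by exists (cst d0) => //; exact: signals_cst.
exact: cost_ge0.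
Qed.

Lemma upper_value_ge0 x : (0 <= upper_value U D gamma h phi x)%E.
Proof.
have [d0 Dd0] := D_nonempty; apply: le_ereal_sup_tmp => /=.
eexists; first by exists (cst (cst d0)) => //;
  apply/nonanticipative_cst/signals_cst.
by apply: le_ereal_inf_tmp => _ /= [u _ <-]; exact: cost_ge0.
Qed.

Lemma lower_invariantE :
  lower_invariant U D h phi = [set x | lower_value U D gamma h phi x = 0%E].
Proof.
apply/seteqP; split => x /= => [inv|V0 e e0 T T0].
  apply/eqP; rewrite eq_le lower_value_ge0 andbT; apply/lee_addgt0Pr => e e0.
  rewrite add0e; have [T T0 Je] := cost_le phi hb g0 e0.
  have [a aS ha] := inv e e0 T T0; apply: ge_ereal_inf.
  eexists; first by exists a.
  by apply: ge_ereal_sup => _ /= [d Dd <-]; apply: Je; exact: ha.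
have : (lower_value U D gamma h phi x < (expR (- (gamma * T)) * e)%:E)%E.
  by rewrite V0 lte_fin mulr_gt0// expR_gt0.
move=> /ereal_inf_lt[_ [a aS <-] /ltW sup_le]; exists a => // d Dd.
apply: (cost_sublevel g0 e0); apply: le_trans sup_le.
by apply: ereal_sup_ubound; exists d.
Qed.

Lemma upper_invariantE :
  upper_invariant U D h phi = [set x | upper_value U D gamma h phi x = 0%E].
Proof.
apply/seteqP; split => x /= => [inv|V0 e e0 T T0 b bS].
  apply/eqP; rewrite eq_le upper_value_ge0 andbT; apply/lee_addgt0Pr => e e0.
  rewrite add0e; have [T T0 Je] := cost_le phi hb g0 e0.
  apply: ge_ereal_sup => _ /= [b bS <-]; have [u uS hu] := inv e e0 T T0 b bS.
  by apply: ge_ereal_inf; eexists; [by exists u | exact: Je].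
have : (ereal_inf [set cost gamma h phi x u (b u) | u in signals U] <
    (expR (- (gamma * T)) * e)%:E)%E.
  apply: (@le_lt_trans _ _ 0%E); last by rewrite lte_fin mulr_gt0// expR_gt0.
  by rewrite -V0; apply: ereal_sup_ubound; exists b.
move=> /ereal_inf_lt[_ [u uS <-] /ltW Je]; exists u => //.
exact: (cost_sublevel g0 e0 Je).
Qed.

End Values.

Theorem lemma2 (R : realType) (n m l : nat)
  (U : set 'rV[R]_m) (D : set 'rV[R]_l)
  (f : 'rV[R]_n -> 'rV[R]_m -> 'rV[R]_l -> 'rV[R]_n)
  (h : 'rV[R]_n -> R) (gamma : R)
  (phi : 'rV[R]_n -> (R -> 'rV[R]_m) -> (R -> 'rV[R]_l) -> R -> 'rV[R]_n)
  (U_compact : compact U) (D_compact : compact D) (D_nonempty : D !=set0)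
  (f_continuous : {within [set: 'rV[R]_n] `*` U `*` D,
    continuous (fun p : 'rV[R]_n * 'rV[R]_m * 'rV[R]_l => f p.1.1 p.1.2 p.2)})
  (f_lipschitz : forall x0 : 'rV[R]_n, exists2 A, nbhs x0 A &
    exists k : R, forall u d, U u -> D d ->
      k.-lipschitz_A (fun x => f x u d))
  (h_bounded : bounded_fun h)
  (h_lipschitz : forall x0 : 'rV[R]_n, exists2 A, nbhs x0 A &
    [lipschitz h x | x in A])
  (gamma_gt0 : 0 < gamma)
  (phi_solution : forall x u d, signals U u -> signals D d ->
    solution f x u d (phi x u d))
  (phi_unique : forall x u d y, signals U u -> signals D d ->
    solution f x u d y -> forall t : R, 0 <= t -> y t = phi x u d t) :
  lower_invariant U D h phi = [set x | lower_value U D gamma h phi x = 0%E] /\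
  upper_invariant U D h phi = [set x | upper_value U D gamma h phi x = 0%E].
Proof. by split; [exact: lower_invariantE | exact: upper_invariantE]. Qed.
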